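(* Let $K$ be a field. For any integers $n$, $q$ and $m$ with $n\ge q\ge m\ge 3$, there exists a connected $m$-hypergraph $H$ of size $n$ such that the square $(I(H)^\vee)^2\subset K[x_1,\dots,x_n]$ of the Alexander dual of the edge ideal of $H$ has an associated prime of height $q$.
   Context: An $m$-hypergraph $H$ of size $n$ consists of a vertex set $\{x_1,\dots,x_n\}$ and an edge set $E$ whose elements are subsets of the vertex set with exactly $m$ distinct elements. The vertices are identified with the variables of $K[x_1,\dots,x_n]$. The edge ideal $I(H)$ is the ideal generated by the monomials $x_{i_1}\cdots x_{i_m}$ with $\{x_{i_1},\dots,x_{i_m}\}\in E$. Its Alexander dual is $I(H)^\vee=\bigcap_{\{x_{i_1},\dots,x_{i_m}\}\in E}(x_{i_1},\dots,x_{i_m})$ (an empty intersection being the whole ring). An associated prime of an ideal $J$ of a ring $R$ means an associated prime of $R/J$. A hypergraph is connected if for any two vertices $x_i$ and $x_j$ there is a sequence of vertices $x_{p_1},\dots,x_{p_r}$ with $x_{p_1}=x_i$, $x_{p_r}=x_j$ such that for all $k<r$ some edge contains both $x_{p_k}$ and $x_{p_{k+1}}$. *)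

(* Defs.v *)
From HB Require Import structures.
From mathcomp Require Import all_boot all_order all_algebra.
From mathcomp Require Import classical_sets.
From mathcomp Require Import mpoly.

Set Implicit Arguments.
Unset Strict Implicit.
Unset Printing Implicit Defensive.

Import GRing.Theory.
Local Open Scope classical_set_scope.
Local Open Scope ring_scope.

(* Ideals are [Prop]-valued sets: the ideals of [ring_quotient] are boolean
   predicates, hence decidable, and are proper by definition. *)
Section Ideals.
Variable R : comNzRingType.
Implicit Types (I J P S : set R) (h : nat).

Definition is_ideal I : Prop :=
  [/\ I 0,
      forall a b, I a -> I b -> I (a + b)
    & forall r a, I a -> I (r * a)].

Definition is_prime_ideal P : Prop :=
  [/\ is_ideal P, ~ P 1 & forall a b, P (a * b) -> P a \/ P b].

Definition ideal_gen S : set R := smallest is_ideal S.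

Definition ideal_mul I J : set R :=
  ideal_gen [set x | exists a b, [/\ I a, J b & x = a * b]].

Fixpoint ideal_exp I (k : nat) : set R :=
  if k is k'.+1 then ideal_mul I (ideal_exp I k') else setT.

(* [colon_elt J f] is (J : f), the annihilator of the class of [f] in the
   [R]-module R/J. *)
Definition colon_elt J (f : R) : set R := [set g | J (g * f)].

Definition associated_prime J P : Prop :=
  is_prime_ideal P /\ exists f : R, P = colon_elt J f.

(* A chain p_0 < p_1 < ... < p_h = P of primes; only p_0, ..., p_h matter.
   [A `<` B] is strict inclusion. *)
Definition prime_chain_to P h : Prop :=
  exists p : nat -> set R,
    [/\ forall i, (i <= h)%N -> is_prime_ideal (p i),
        forall i, (i < h)%N -> p i `<` p i.+1
      & p h = P].

Definition has_height P h : Prop :=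
  prime_chain_to P h /\ forall k, prime_chain_to P k -> (k <= h)%N.

End Ideals.

Record hypergraph (m n : nat) := Hypergraph {
  edges : {set {set 'I_n}};
  edges_uniform : forall e, e \in edges -> #|e| = m
}.

Section Hypergraphs.
Variables (m n : nat) (H : hypergraph m n).

Definition share_edge : rel 'I_n :=
  [rel i j | [exists e in edges H, (i \in e) && (j \in e)]].

Definition hypergraph_connected : Prop :=
  forall i j : 'I_n, connect share_edge i j.

Variable K : fieldType.

Definition vertex_ideal (e : {set 'I_n}) : set {mpoly K[n]} :=
  ideal_gen [set p | exists2 i : 'I_n, i \in e & p = 'X_i].

(* The Alexander dual of the edge ideal of H; over an empty edge set,
   [\bigcap] is the whole ring. *)
Definition edge_ideal_dual : set {mpoly K[n]} :=
  \bigcap_(e in [set` edges H]) vertex_ideal e.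

End Hypergraphs.

Arguments vertex_ideal {n} K e.
Arguments edge_ideal_dual {m n} H K.

(* Main.v *)
Require Import Defs.
From mathcomp Require Import all_boot all_algebra.
From mathcomp Require Import classical_sets boolp.
From mathcomp Require Import mpoly.
From mathcomp Require Import zify.

Set Implicit Arguments.
Unset Strict Implicit.
Unset Printing Implicit Defensive.

Import GRing.Theory.

(** The Alexander dual [I] consists of the polynomials whose monomials are all
    supported on vertex covers, so [I ^ 2] is spanned by the monomials divisible
    by a product of two covers. For a set [Q] of vertices let [P_Q] be the ideal
    generated by the variables of [Q]. It is the annihilator of a monomial [f]
    modulo [I ^ 2] as soon as no product of two covers divides [f] in the
    variables of [Q], while such a product divides [x_i f] for each [i] in [Q]
    ([associated_of_covers]).

    Take for [Q] the first [q] vertices. The sets of [m] vertices that leave [Q]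
    are all edges; they make the vertices outside [Q] harmless for
    connectedness, and they are met by any set containing the complement of
    [Q], whose variables occur squared in [f]. Inside [Q] a critical
    obstruction to 2-colouring is needed. If [q = m], the single edge [Q] is one,
    with [f] containing one variable of [Q]. If [q > m], one of [q - m + 2] and
    [q - m + 1] is an odd number [k > 1]; the edges inside [Q] are those of a
    cycle on the first [k] vertices, enlarged to [m]-sets by vertices among the
    other [q - k], and [f] contains the first [k] variables. Two covers with
    product dividing [f] would give a proper 2-colouring of an odd cycle. On
    the other hand, a colouring with one monochromatic edge is repaired as soon
    as one vertex of this edge, be it on the cycle or not, may be used once more
    ([odd_cycle_critical]); that every vertex outside the cycle lies in an edge
    uses [m >= 3].

    That [P_Q] has height [#|Q|] follows from the bound [n] on the length of
    chains of primes in [K[x_1, ..., x_n]] ([prime_chain_le]): adding variables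
    one at a time extends the one-term chain of the zero ideal to a chain of
    length [#|Q|] ending at [P_Q], and a chain ending at [P_Q] to one ending at
    the ideal of all the variables. For the bound, [n + 1] elements [y_l] of
    [p_(l+1)] outside [p_l] satisfy an algebraic relation
    ([alg_dependent]), whose value [0] lies in [p_0]. Dividing it by the least
    power of [y_0] that occurs and dropping the multiples of [y_0], which lie in
    [p_1], leaves a nontrivial relation between [y_1, ..., y_n] modulo [p_1].
    Repeating this with [y_1], [y_2] and so on leaves a nonzero constant in the
    last prime. *)

(** * Monomial ideals *)

Section MonomialIdeals.
Local Open Scope classical_set_scope.
Local Open Scope ring_scope.

Variables (K : fieldType) (n : nat).
Implicit Types (S T : set 'X_{1..n}) (p q : {mpoly K[n]}) (Q : {set 'I_n}).

(** Ideals of the monoid of monomials. *)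
Definition monoid_ideal S := forall m m', S m -> S (m' + m)%MM.

(** The polynomials all of whose monomials lie in [S]. *)
Definition mon_span S : set {mpoly K[n]} :=
  [set p | forall m, m \in msupp p -> S m].

(** The products of a monomial of [S] and one of [T]. *)
Definition monoid_mul S T : set 'X_{1..n} :=
  [set m | exists m1 m2, [/\ S m1, T m2 & m = (m1 + m2)%MM]].

Lemma mon_span_ideal S : monoid_ideal S -> is_ideal (mon_span S).
Proof.
move=> upS; split=> [m|p q hp hq m|r p hp m]; first by rewrite msupp0.
- by move/msuppD_le; rewrite mem_cat => /orP[/hp|/hq].
- by move/msuppM_le=> /allpairsP[[m1 m2] [/= _ /hp Sm ->]]; exact: upS.
Qed.

Lemma ideal_gen_ideal (R : comNzRingType) (G : set R) : is_ideal (ideal_gen G).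
Proof.
split; [by move=> J [[]] | move=> a b ha hb J hJ | move=> r a ha J hJ].
- by case: (hJ) => -[_ hD _] _; apply: hD; [apply: ha|apply: hb].
- by case: (hJ) => -[_ _ hM] _; apply: hM; apply: ha.
Qed.

Lemma ideal_sum (R : comNzRingType) (J : set R) (I : eqType) (r : seq I) F :
  is_ideal J -> (forall i, i \in r -> J (F i)) -> J (\sum_(i <- r) F i).
Proof. by case=> J0 JD _ h; rewrite big_seq; apply: big_ind. Qed.

(** An ideal containing the monomials of [S] contains their span. *)
Lemma mon_span_min S (J : set {mpoly K[n]}) :
  is_ideal J -> (forall m, S m -> J 'X_[m]) -> mon_span S `<=` J.
Proof.
move=> hJ SJ p hp; rewrite (mpolyE p); apply: ideal_sum => // m /hp /SJ.
by rewrite -mul_mpolyC; case: hJ => _ _; apply.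
Qed.

Lemma mon_spanX S m : mon_span S 'X_[m] <-> S m.
Proof.
rewrite /mon_span /= msuppX; split=> [|Sm m']; first by apply; rewrite inE.
by rewrite inE => /eqP->.
Qed.

Lemma mon_span_mulX S m p :
  mon_span S (p * 'X_[m]) <-> mon_span [set m' | S (m' + m)%MM] p.
Proof.
split=> h m'.
- by move=> hm'; apply: (h (m' + m)%MM); rewrite mcoeff_msupp addmC mcoeffMX -mcoeff_msupp.
- move/msuppM_le=> /allpairsP[[m1 m2] [/= /h hm1]].
  by rewrite msuppX inE => /eqP-> ->.
Qed.

Lemma ideal_mul_mon_span S T : monoid_ideal S -> monoid_ideal T ->
  ideal_mul (mon_span S) (mon_span T) = mon_span (monoid_mul S T).
Proof.
move=> upS upT; apply/seteqP; split.
- apply: smallest_sub.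
  + apply: mon_span_ideal => m m' [m1 [m2 [h1 h2 ->]]].
    by exists (m' + m1)%MM, m2; rewrite addmA; split=> //; exact: upS.
  + move=> p /= [a [b [ha hb ->]]] m.
    move/msuppM_le=> /allpairsP[[m1 m2] [/= /ha h1 /hb h2 ->]].
    by exists m1, m2.
- apply: mon_span_min; first exact: ideal_gen_ideal.
  move=> _ [m1 [m2 [h1 h2 ->]]]; apply: sub_gen_smallest.
  by exists 'X_[m1], 'X_[m2]; rewrite mpolyXD; split=> //; apply/mon_spanX.
Qed.

Lemma ideal_exp2_mon_span S : monoid_ideal S ->
  ideal_exp (mon_span S) 2 = mon_span (monoid_mul S S).
Proof.
move=> upS; have TE : setT = mon_span setT by apply/seteqP; split.
rewrite /= TE !ideal_mul_mon_span //; last first.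
  move=> m m' [m1 [m2 [h1 _ ->]]]; exists (m' + m1)%MM, m2; rewrite addmA.
  by split=> //; exact: upS.
congr (mon_span (monoid_mul S _)); apply/seteqP; split=> [m|m Sm].
- by case=> m1 [m2 [h1 _ ->]]; rewrite addmC; exact: upS.
- by exists m, 0%MM; rewrite addm0.
Qed.

(** * Ideals generated by variables *)

(** The monomials divisible by a variable with index in [Q]. *)
Definition meets Q : set 'X_{1..n} :=
  [set m | exists2 i, i \in Q & m i != 0%N].

Lemma meets_ideal Q : monoid_ideal (meets Q).
Proof.
by move=> m m' [i iQ mi]; exists i => //; rewrite mnmDE addn_eq0 negb_and mi orbT.
Qed.

Lemma vertex_idealE Q : vertex_ideal K Q = mon_span (meets Q).
Proof.
apply/seteqP; split.
- apply: smallest_sub; first exact/mon_span_ideal/meets_ideal.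
  move=> _ [i iQ ->]; apply/mon_spanX; exists i => //.
  by rewrite mnm1E eqxx.
- apply: mon_span_min; first exact: ideal_gen_ideal.
  move=> m [i iQ mi].
  have -> : m = (m - U_(i) + U_(i))%MM by rewrite submK // lep1mP.
  rewrite mpolyXD.
  case: (@ideal_gen_ideal {mpoly K[n]} [set p | exists2 i, i \in Q & p = 'X_i]).
  move=> _ _; apply.
  by apply: sub_gen_smallest; exists i.
Qed.

(** The substitution sending the variables of [Q] to [0] and fixing the
    others; its kernel is the ideal generated by these variables. *)
Definition kill Q p : {mpoly K[n]} :=
  p \mPo [tuple if i \in Q then 0 else 'X_i | i < n].

Lemma killX_out Q m : ~ meets Q m -> kill Q 'X_[m] = 'X_[m].
Proof.
move=> hm; rewrite /kill comp_mpolyX mpolyXE_id; apply: eq_bigr => i _.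
rewrite tnth_mktuple; case: ifP => // iQ.
have /eqP -> : m i == 0%N by apply: contrapT => /negP mi; apply: hm; exists i.
by rewrite !expr0.
Qed.

Lemma killX_in Q m : meets Q m -> kill Q 'X_[m] = 0.
Proof.
case=> i iQ mi; rewrite /kill comp_mpolyX (bigD1 i) //= tnth_mktuple iQ.
by rewrite expr0n (negPf mi) mul0r.
Qed.

Lemma vertex_ideal_kill Q p : vertex_ideal K Q p <-> kill Q p = 0.
Proof.
rewrite vertex_idealE; split=> [hp|kp].
- rewrite (mpolyE p) /kill raddf_sum big_seq big1 // => m /hp hm.
  by rewrite /= comp_mpolyZ -/(kill _ _) killX_in // scaler0.
- have hJ := mon_span_ideal (@meets_ideal Q); case: (hJ) => J0 JD JM.
  suff h : mon_span (meets Q) (p - kill Q p) by move: h; rewrite kp subr0.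
  elim/mpolyind: {kp}p => [|c m p _ _ IH]; first by rewrite /kill raddf0 subr0.
  have -> : kill Q (c *: 'X_[m] + p) = c *: kill Q 'X_[m] + kill Q p.
    by rewrite /kill raddfD /= comp_mpolyZ.
  rewrite opprD addrACA -scalerBr -mul_mpolyC; apply: JD => //; apply: JM.
  case: (pselect (meets Q m)) => hm.
  + by rewrite killX_in // subr0; apply/mon_spanX.
  + by rewrite killX_out // subrr.
Qed.

Lemma vertex_ideal_prime Q : is_prime_ideal (vertex_ideal K Q).
Proof.
split; first exact: ideal_gen_ideal.
- move/vertex_ideal_kill; rewrite /kill comp_mpoly1 => /eqP.
  by rewrite oner_eq0.
- move=> a b /vertex_ideal_kill.
  rewrite /kill (@rmorphM _ _ (comp_mpoly _)) => /eqP.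
  by rewrite mulf_eq0 => /orP[] /eqP h; [left|right]; apply/vertex_ideal_kill.
Qed.

Lemma vertex_idealX Q i : vertex_ideal K Q 'X_i <-> i \in Q.
Proof.
rewrite vertex_idealE mon_spanX; split=> [[j jQ]|iQ].
- by rewrite /= mnm1E; case: (i =P j) => [->|].
- by exists i => //; rewrite mnm1E eqxx.
Qed.

End MonomialIdeals.

(** * The dimension of a polynomial ring *)

Section Dimension.
Local Open Scope classical_set_scope.
Local Open Scope ring_scope.

Variables (K : fieldType) (n : nat).
Implicit Types (p q : {mpoly K[n]}) (P : set {mpoly K[n]}) (Q : {set 'I_n}).

(** Every variable occurs in [p] with exponent at most [d]. *)
Definition deg_le d p :=
  forall m : 'X_{1..n}, m \in msupp p -> forall i, (m i <= d)%N.

Lemma deg_leM d e p q : deg_le d p -> deg_le e q -> deg_le (d + e) (p * q).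
Proof.
move=> hp hq m /msuppM_le /allpairsP[[m1 m2] [/= /hp h1 /hq h2 ->]] i.
by rewrite mnmDE leq_add.
Qed.

Lemma deg_le1 : deg_le 0 1.
Proof. by move=> m; rewrite msupp1 inE => /eqP-> i; rewrite mnm0E. Qed.

Lemma deg_le_prod (I : Type) (s : seq I) (F : I -> {mpoly K[n]}) (d : I -> nat) :
  (forall i, deg_le (d i) (F i)) ->
  deg_le (\sum_(i <- s) d i) (\prod_(i <- s) F i).
Proof.
move=> h; elim: s => [|i s IH]; first by rewrite !big_nil; exact: deg_le1.
by rewrite !big_cons; apply: deg_leM.
Qed.

Lemma deg_leX d p k : deg_le d p -> deg_le (k * d) (p ^+ k).
Proof.
move=> h; elim: k => [|k IH]; first exact: deg_le1.
by rewrite exprS mulSn; apply: deg_leM.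
Qed.

Lemma deg_le_trans d e p : (d <= e)%N -> deg_le d p -> deg_le e p.
Proof. by move=> de h m /h hm i; exact: leq_trans (hm i) de. Qed.

Lemma deg_le_msize p : deg_le (msize p) p.
Proof.
move=> m /msize_mdeg_lt hm i; apply: leq_trans (ltnW hm).
by rewrite mdegE (bigD1 i) //= leq_addr.
Qed.

(** A family of more vectors than coordinates is linearly dependent. *)
Lemma lin_dependent (F T : finType) (v : F -> T -> K) : (#|T| < #|F|)%N ->
  exists c : F -> K,
    (exists a, c a != 0) /\ forall t, \sum_a c a * v a t = 0.
Proof.
move=> TF; pose A := \matrix_(i < #|F|, j < #|T|) v (enum_val i) (enum_val j).
have : kermx A != 0.
  rewrite -mxrank_eq0 mxrank_ker subn_eq0 -ltnNge.
  exact: leq_ltn_trans (rank_leq_col A) TF.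
case/rowV0Pn=> u /sub_kermxP uA u0.
exists (fun a => u 0 (enum_rank a)); split.
  apply: contrapT => h; case/negP: u0; apply/eqP/rowP => j; rewrite mxE.
  apply/eqP; apply: contrapT => /negP uj; apply: h.
  by exists (enum_val j); rewrite enum_valK.
move=> t; have := congr1 (fun B : 'rV__ => B 0 (enum_rank t)) uA.
rewrite !mxE => {2}<-; rewrite (reindex (@enum_val F F)) /=; last first.
  by exists enum_rank => i _; rewrite ?enum_valK ?enum_rankK.
by apply: eq_bigr => i _; rewrite mxE enum_valK enum_rankK.
Qed.

(** More than [n] polynomials in [n] variables are algebraically dependent:
    the [N ^ r] monomials of exponents below [N] in [r] polynomials live in a
    space of dimension [O(N ^ n)]. *)
Lemma alg_dependent r (y : 'I_r -> {mpoly K[n]}) : (n < r)%N ->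
  exists N (c : {ffun 'I_r -> 'I_N} -> K),
    (exists a, c a != 0) /\
    \sum_a c a *: \prod_l y l ^+ a l = 0.
Proof.
move=> nr; pose D := (\max_l msize (y l))%N.
pose N := (((r * D).+1 ^ n).+1)%N; pose M := (r * (N * D)).+1.
pose mon (t : {ffun 'I_n -> 'I_M}) : 'X_{1..n} := [multinom (t i : nat) | i < n].
have degY (a : {ffun 'I_r -> 'I_N}) : deg_le (r * (N * D)) (\prod_l y l ^+ a l).
  apply: (@deg_le_trans (\sum_(l < r) (N * D))); last apply: deg_le_prod.
    by rewrite sum_nat_const cardT size_enum_ord.
  move=> l; apply: (@deg_le_trans (a l * msize (y l))); last exact/deg_leX/deg_le_msize.
  by rewrite leq_mul ?(leq_bigmax l) // ltnW.
have [|c [c0 hc]] := @lin_dependent {ffun 'I_r -> 'I_N} {ffun 'I_n -> 'I_M}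
    (fun a t => (\prod_l y l ^+ a l)@_(mon t)).
  rewrite !card_ffun !card_ord.
  have MN : (M <= (r * D).+1 * N)%N.
    by rewrite /M mulSn mulnAC -mulnA addnC -addn1 leq_add2l.
  apply: (@leq_ltn_trans (((r * D).+1 * N) ^ n)); first by case: (n) => // ?; rewrite leq_exp2r.
  apply: (@leq_trans (N ^ n.+1)); last by rewrite leq_pexp2l.
  by rewrite expnMn expnS ltn_pmul2r ?expn_gt0 // ltnSn.
exists N, c; split=> //; apply/mpolyP => m; rewrite mcoeff0 raddf_sum /=.
have [hm|hm] := boolP [forall i, (m i < M)%N].
- have -> : m = mon [ffun i => inord (m i)].
    apply/mnmP => i; rewrite mnmE ffunE inordK //; exact: (forallP hm i).
  by rewrite -[RHS](hc [ffun i => inord (m i)]); apply: eq_bigr => a _; rewrite mcoeffZ.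
- rewrite big1 // => a _; rewrite mcoeffZ [X in _ * X](_ : _ = 0) ?mulr0 //.
  apply/eqP; rewrite mcoeff_eq0; apply: contra hm => /degY h.
  by apply/forallP => i; rewrite ltnS.
Qed.

Lemma prime_ideal_exp (R : comNzRingType) (J : set R) x k :
  is_prime_ideal J -> J (x ^+ k) -> J x.
Proof.
move=> [_ J1 JM]; elim: k => [|k IH]; first by rewrite expr0 => /J1.
by rewrite exprS => /JM[].
Qed.

(** The step of the lexicographic descent: after dividing a relation by the
    least power of [x] in it, only the terms with this least exponent survive
    modulo [x]. *)
Lemma relation_descent (A : finType) (J J' : set {mpoly K[n]}) x k
    (e : A -> nat) (c : A -> K) (F : A -> {mpoly K[n]}) (B : pred A) :
  is_prime_ideal J -> is_ideal J' -> J `<=` J' -> ~ J x -> J' x ->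
  (forall a, B a -> c a != 0 -> (k <= e a)%N) ->
  J (\sum_(a | B a) c a *: (x ^+ e a * F a)) ->
  J' (\sum_(a | B a && (e a == k)) c a *: F a).
Proof.
move=> hJ [J'0 J'D J'M] JJ' Jx J'x ke.
have -> : \sum_(a | B a) c a *: (x ^+ e a * F a) =
    x ^+ k * \sum_(a | B a) c a *: (x ^+ (e a - k) * F a).
  rewrite mulr_sumr; apply: eq_bigr => a Ba.
  have [->|ca] := eqVneq (c a) 0; first by rewrite !scale0r mulr0.
  by rewrite -scalerAr mulrA -exprD subnKC // ke.
case: (hJ) => _ _ /[apply] -[/(prime_ideal_exp hJ)//|/JJ'].
rewrite (bigID (fun a => e a == k)) /= => h.
have h2 : J' (\sum_(a | B a && (e a != k)) c a *: (x ^+ (e a - k) * F a)).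
  apply: big_ind => // a /andP[Ba ea].
  have [->|ca] := eqVneq (c a) 0; first by rewrite scale0r.
  have : (0 < e a - k)%N by rewrite subn_gt0 ltn_neqAle eq_sym ea ke.
  case: (_ - _)%N => // d _.
  by rewrite -mul_mpolyC exprS -mulrA mulrCA mulrC; apply: J'M.
have -> : \sum_(a | B a && (e a == k)) c a *: F a =
    \sum_(a | B a && (e a == k)) c a *: (x ^+ (e a - k) * F a).
  by apply: eq_bigr => a /andP[_ /eqP->]; rewrite subnn mul1r.
have := J'D _ _ h (J'M (-1) _ h2).
by rewrite mulN1r addrK.
Qed.

(** A chain of primes in [K[x_1, ..., x_n]] has length at most [n]. In a relation
    between elements [y_l] of [p_(l+1)] outside [p_l], the exponents of
    [y_0, ..., y_(i-1)] are fixed successively by [relation_descent]. *)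
Lemma prime_chain_le r (p : nat -> set {mpoly K[n]}) :
  (forall i, (i <= r)%N -> is_prime_ideal (p i)) ->
  (forall i, (i < r)%N -> p i `<` p i.+1) -> (r <= n)%N.
Proof.
move=> pP pS; rewrite leqNgt; apply/negP => nr.
have /choice[y hy] : forall l : 'I_r, exists y, p l.+1 y /\ ~ p l y.
  move=> l; case: (pS l (ltn_ord l)) => _ /existsNP[y /not_implyP hy].
  by exists y.
have [N [c [[a0 ca0] hc]]] := alg_dependent y nr.
pose agree i (g a : {ffun 'I_r -> 'I_N}) :=
  [forall l : 'I_r, (l < i)%N ==> (a l == g l)].
have H i : (i <= r)%N -> exists g, c g != 0 /\
    p i (\sum_(a | agree i g a) c a *: \prod_(l < r | (i <= l)%N) y l ^+ a l).
  elim: i => [_|i IH ir].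
    exists a0; split=> //; rewrite (eq_bigl xpredT) ?hc; last first.
      by move=> a; apply/forallP.
    by case: (pP 0%N isT) => -[].
  have [g [cg hg]] := IH (ltnW ir); pose i' := Ordinal ir.
  (* [g'] has the least exponent of [y i'] in the remaining relation. *)
  have gg : agree i g g && (c g != 0).
    by rewrite cg andbT; apply/forallP => l; rewrite eqxx implybT.
  pose g' := [arg min_(a < g | agree i g a && (c a != 0%R)) (a i' : nat)]%N.
  have [/andP[gg' cg'] minP] : agree i g g' && (c g' != 0) /\
      forall a, agree i g a && (c a != 0) -> (g' i' <= a i')%N.
    by rewrite /g'; case: arg_minnP.
  exists g'; split=> //.
  have -> : \sum_(a | agree i.+1 g' a)
        c a *: \prod_(l < r | (i < l)%N) y l ^+ a l =
      \sum_(a | agree i g a && ((a i' : nat) == g' i'))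
        c a *: \prod_(l < r | (i < l)%N) y l ^+ a l.
    apply: eq_bigl => a; apply/forallP/andP => [h|[/forallP h1 /eqP h2] l].
      split; last by have := h i'; rewrite ltnS leqnn /= => /eqP->.
      apply/forallP => l; apply/implyP => li.
      have := h l; rewrite ltnS ltnW //= => /eqP->.
      by move/forallP/(_ l): gg'; rewrite li.
    rewrite ltnS leq_eqVlt; apply/implyP => /orP[/eqP li|li].
      have -> : l = i' by apply/val_inj.
      by apply/eqP/val_inj.
    have := h1 l; rewrite li => /eqP->.
    by move/forallP/(_ l): gg'; rewrite li eq_sym.
  have [yi yi'] := hy i'.
  apply: (@relation_descent _ (p i) _ (y i')) (pP _ (ltnW ir)) _ _ yi' yi _ _.
  - by case: (pP _ ir).
  - by case: (pS _ ir).
  - by move=> a ga ca; apply: minP; rewrite ga.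
  - move: hg; congr (p i _); apply: eq_bigr => a _; congr (_ *: _).
    rewrite (bigD1 i') //=; congr (_ * _); apply: eq_bigl => l.
    by rewrite ltn_neqAle andbC eq_sym.
have [g [cg]] := H r (leqnn r).
rewrite (big_pred1 g) => [|a]; last first.
  apply/forallP/eqP => [h|-> l]; last by rewrite eqxx implybT.
  by apply/ffunP => l; apply/eqP; have := h l; rewrite ltn_ord.
rewrite big_pred0 => [|l]; last by rewrite leqNgt ltn_ord.
case: (pP r (leqnn r)) => -[_ _ pM] p1 _ h; apply: p1.
by have := pM (c g)^-1%:MP _ h; rewrite mul_mpolyC scalerA mulVf // scale1r.
Qed.

Lemma prime_chain_adjoin Q w k : w \notin Q ->
  prime_chain_to (vertex_ideal K Q) k ->
  prime_chain_to (vertex_ideal K (w |: Q)) k.+1.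
Proof.
move=> wQ [p [pP pS pk]].
exists (fun i => if (i <= k)%N then p i else vertex_ideal K (w |: Q)); split.
- by move=> i _; case: ifP => [/pP//|_]; exact: vertex_ideal_prime.
- move=> i; rewrite ltnS => ik; rewrite ik; case: ltnP => [/pS//|ki].
  have -> : i = k by apply/eqP; rewrite eqn_leq ik.
  rewrite pk; split=> [|/(_ 'X_w) h].
    rewrite !vertex_idealE => f hf m /hf [j jQ mj].
    by exists j => //; rewrite inE jQ orbT.
  have wwQ : w \in w |: Q by rewrite setU11.
  by apply: (negP wQ); move/vertex_idealX: (h ((vertex_idealX K _ _).2 wwQ)).
- by rewrite ltnn.
Qed.

Lemma prime_chain_sub Q Q' k : Q \subset Q' ->
  prime_chain_to (vertex_ideal K Q) k ->
  prime_chain_to (vertex_ideal K Q') (k + #|Q' :\: Q|).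
Proof.
move E : #|Q' :\: Q| => d; elim: d Q k E => [|d IH] Q k E sQ hQ.
  have -> : Q' = Q; last by rewrite addn0.
  by apply/eqP; rewrite finset.eqEsubset sQ andbT -finset.setD_eq0 -cards_eq0 E.
have /set0Pn[w] : Q' :\: Q != finset.set0 by rewrite -cards_eq0 E.
rewrite inE => /andP[wQ wQ']; rewrite addnS -addSn; apply: (IH (w |: Q)).
- by move: E; rewrite (cardsD1 w) inE wQ wQ' => -[<-]; rewrite finset.setDDl finset.setUC.
- by rewrite finset.subUset finset.sub1set wQ'.
- exact: prime_chain_adjoin.
Qed.

(** A longer chain would extend, through the ideals of larger sets of variables,
    to one of length more than [n]. *)
Lemma vertex_ideal_height Q : has_height (vertex_ideal K Q) #|Q|.
Proof.
split.
- have := @prime_chain_sub finset.set0 Q 0 (finset.sub0set Q).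
  rewrite finset.setD0 add0n; apply.
  exists (fun=> vertex_ideal K finset.set0); split=> // i _.
  exact: vertex_ideal_prime.
- move=> k /(prime_chain_sub (finset.subsetT Q)) [p [pP pS _]].
  have := prime_chain_le pP pS; rewrite finset.setTD.
  by have := cardsC Q; rewrite card_ord; lia.
Qed.

End Dimension.

(** * Associated primes of the squared dual, in terms of covers *)

Section Covers.
Local Open Scope classical_set_scope.
Local Open Scope ring_scope.

Variables (m n : nat) (H : hypergraph m n) (K : fieldType).

(** Vertex covers: sets of vertices meeting every edge. *)
Definition is_cover (C : {set 'I_n}) :=
  forall e, e \in edges H -> exists2 i, i \in e & i \in C.

(** The squarefree part of a monomial as a set of variables, and conversely. *)
Definition support (u : 'X_{1..n}) : {set 'I_n} := [set i | u i != 0%N]%SET.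
Definition indicator (C : {set 'I_n}) : 'X_{1..n} :=
  [multinom ((i \in C) : nat) | i < n].

Lemma edge_ideal_dualE :
  edge_ideal_dual H K = mon_span [set u | is_cover (support u)].
Proof.
apply/seteqP; split=> p /= hp.
- move=> u hu e eH; have := hp e eH; rewrite vertex_idealE.
  by move=> /(_ u hu) [i ie ui]; exists i => //; rewrite inE.
- move=> e eH; rewrite vertex_idealE => u /hp /(_ e eH) [i ie].
  by rewrite inE => ui; exists i.
Qed.

Lemma cover_ideal : monoid_ideal [set u | is_cover (support u)].
Proof.
move=> u u' hu e /hu[i ie]; rewrite inE => ui; exists i => //.
by rewrite inE mnmDE addn_eq0 negb_and ui orbT.
Qed.

Lemma support_indicator C : support (indicator C) = C.
Proof. by apply/setP => i; rewrite inE mnmE; case: (i \in C). Qed.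

(** A monomial criterion: [a] is not divisible, on [Q], by the product of two
    covers, but it becomes so after multiplication by any variable of [Q]. *)
Lemma associated_of_covers (Q : {set 'I_n}) (a : 'X_{1..n}) :
  (forall C1 C2, is_cover C1 -> is_cover C2 ->
     ~ forall i, i \in Q -> ((i \in C1) + (i \in C2) <= a i)%N) ->
  (forall i, i \in Q -> exists C1 C2, [/\ is_cover C1, is_cover C2 &
     forall j, ((j \in C1) + (j \in C2) <= a j + (i == j))%N]) ->
  associated_prime (ideal_exp (edge_ideal_dual H K) 2) (vertex_ideal K Q).
Proof.
move=> no yes; split; first exact: vertex_ideal_prime.
exists 'X_[a]; rewrite edge_ideal_dualE (ideal_exp2_mon_span _ cover_ideal).
rewrite vertex_idealE; apply/seteqP; split=> g hg.
- apply/mon_span_mulX => u /hg [i /yes[C1 [C2 [h1 h2 h12]]] ui].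
  exists (u + a - indicator C2)%MM, (indicator C2).
  have le2 : (indicator C1 + indicator C2 <= u + a)%MM.
    apply/mnm_lepP => j; rewrite !mnmDE !mnmE; apply: leq_trans (h12 j) _.
    by rewrite addnC leq_add2r; case: eqP => // <-; rewrite lt0n.
  have le2' : (indicator C2 <= u + a)%MM.
    exact: lepm_trans (lem_addl _ _) le2.
  split; [|by rewrite /= support_indicator|by rewrite submK].
  rewrite -[(_ - _)%MM](submK (_ : (indicator C1 <= _)%MM)); last first.
    apply/mnm_lepP => j; move/mnm_lepP/(_ j): le2.
    by rewrite mnmBE !mnmDE => h; rewrite leq_subRL ?(leq_trans (leq_addl _ _) h) // addnC.
  by apply: cover_ideal; rewrite /= support_indicator.
- move/mon_span_mulX: hg => hg u /hg [u1 [u2 [h1 h2 E]]].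
  apply: contrapT => hu; apply: (no _ _ h1 h2) => i iQ.
  have /eqP ui : u i == 0%N by apply: contrapT => /negP ui; apply: hu; exists i.
  have := congr1 (fun v : 'X_{1..n} => v i) E; rewrite !mnmDE ui add0n => ->.
  by apply: leq_add; rewrite inE; [case: (u1 i)|case: (u2 i)].
Qed.

End Covers.

(** * Combinatorial constructions *)

Section Construction.

Variables (m n q : nat).
Implicit Types (base : pred {set 'I_n}).

Lemma card_interval (N a b : nat) : b <= N ->
  #|[set x : 'I_N | a <= x < b]| = b - a.
Proof.
elim: b => [_|b IH bN].
  by apply/eqP; rewrite cards_eq0; apply/eqP/finset.setP => x; rewrite !inE; lia.
have [ab|ba] := leqP a b; last first.
  have -> : b.+1 - a = 0 by lia.
  by apply/eqP; rewrite cards_eq0; apply/eqP/finset.setP => x; rewrite !inE; lia.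
have -> : [set x : 'I_N | a <= x < b.+1] =
    Ordinal bN |: [set x : 'I_N | a <= x < b].
  by apply/finset.setP => x; rewrite !inE -val_eqE /=; lia.
by rewrite cardsU1 IH ?(ltnW bN) // !inE /= ltnn andbF; lia.
Qed.

(** The union of two intervals of vertices. *)
Definition two_intervals (N a b c d : nat) : {set 'I_N} :=
  [set x : 'I_N | (a <= x < b) || (c <= x < d)].

Lemma card_two_intervals (N a b c d : nat) : b <= c -> c <= d -> d <= N ->
  #|two_intervals N a b c d| = (b - a) + (d - c).
Proof.
move=> bc cd dN; rewrite -(@card_interval N a b) ?(leq_trans bc) ?(leq_trans cd) //.
rewrite -(card_interval c dN) -[RHS]subn0 -(cards0 'I_N).
have <- : [set x : 'I_N | a <= x < b] :&: [set x : 'I_N | c <= x < d] = finset.set0.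
  by apply/finset.setP => x; rewrite !inE; lia.
by rewrite -cardsU; congr #|pred_of_set _|; apply/finset.setP => x; rewrite !inE.
Qed.

Lemma ex_superset (T : finType) (A : {set T}) k : #|A| <= k <= #|T| ->
  exists2 B : {set T}, A \subset B & #|B| = k.
Proof.
case/andP=> /subnKC <-; elim: (k - _) => [|d IH]; first by rewrite addn0; exists A.
rewrite addnS => dT; have [B AB cB] := IH (ltnW dT).
have /finset.set0Pn[x] : ~: B != finset.set0.
  by rewrite -cards_eq0; have := cardsC B; rewrite cB; lia.
rewrite inE => xB; exists (x |: B); first exact: fintype.subset_trans AB (finset.subsetU1 _ _).
by rewrite cardsU1 xB cB.
Qed.

(** The hypergraph whose edges are the sets of [m] vertices that satisfy [base]
    or contain a vertex of index at least [q]. *)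
Definition base_edges (base : pred {set 'I_n}) : {set {set 'I_n}} :=
  [set e : {set 'I_n} | (#|e| == m) && (base e || [exists i in e, q <= i])].

Lemma base_edges_uniform base e : e \in base_edges base -> #|e| = m.
Proof. by rewrite inE => /andP[/eqP]. Qed.

Definition base_hypergraph base : hypergraph m n :=
  Hypergraph (@base_edges_uniform base).

Lemma share_edge_sym (H : hypergraph m n) : ssrbool.symmetric (share_edge H).
Proof. by move=> i j; apply: eq_existsb => e; rewrite (andbC (i \in e)). Qed.

(** Vertices of index at least [q] lie in an edge with any other vertex, so
    only the connectedness of the first [q] vertices is at stake. *)
Lemma base_connected base (v0 : 'I_n) : 2 <= m <= n ->
  (forall i : 'I_n, i < q -> connect (share_edge (base_hypergraph base)) i v0) ->
  hypergraph_connected (base_hypergraph base).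
Proof.
move=> /andP[m2 mn] hconn.
suff to0 i : connect (share_edge (base_hypergraph base)) i v0.
  move=> i j; apply: connect_trans (to0 i) _.
  by rewrite (@fingraph.sym_connect_sym _ _ (share_edge_sym _)).
have [/hconn//|qi] := ltnP i q; apply: connect1.
have [|e /fintype.subsetP sub ce] := @ex_superset _ [set i; v0] m.
  by rewrite cards2 card_ord mn andbT (leq_trans _ m2) //; case: eqP.
apply/existsP; exists e; rewrite !sub ?inE ?eqxx ?orbT // andbT ce eqxx /=.
by rewrite andbT; apply/orP; right; apply/existsP; exists i; rewrite sub ?inE ?eqxx.
Qed.

(** The squarefree monomial in the first [k] variables times the squares of the
    variables of index at least [q]. *)
Definition witness k : 'X_{1..n} :=
  [multinom (if i < k then 1 else if i < q then 0 else 2)%N | i < n].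

Lemma base_cover base (C : {set 'I_n}) :
  (forall i : 'I_n, q <= i -> i \in C) ->
  (forall e, base e -> exists2 i, i \in e & i \in C) ->
  is_cover (base_hypergraph base) C.
Proof.
move=> qC bC e; rewrite inE => /andP[_ /orP[/bC//|/existsP[i /andP[ie /qC]]]].
by exists i.
Qed.

(** The criterion for [witness k]: only the edges satisfying [base], and only the
    first [q] vertices, matter. *)
Lemma base_associated (K : fieldType) base k :
  q <= n -> k <= q ->
  (forall C1 C2 : {set 'I_n},
     is_cover (base_hypergraph base) C1 -> is_cover (base_hypergraph base) C2 ->
     (forall i : 'I_n, i < q -> (i \in C1) + (i \in C2) <= (i < k)) -> False) ->
  (forall i : 'I_n, i < q -> exists C1 C2 : {set 'I_n},
     [/\ forall e, base e -> exists2 x, x \in e & x \in C1,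
         forall e, base e -> exists2 x, x \in e & x \in C2,
         forall x : 'I_n, q <= x -> (x \in C1) && (x \in C2)
       & forall x : 'I_n, x < q ->
           (x \in C1) + (x \in C2) <= (x < k) + (i == x)]) ->
  exists P : set {mpoly K[n]},
    associated_prime
      (ideal_exp (edge_ideal_dual (base_hypergraph base) K) 2) P /\
    has_height P q.
Proof.
move=> qn kq no yes; pose Q := [set x : 'I_n | 0 <= x < q].
exists (vertex_ideal K Q); split; last first.
  by rewrite -[X in has_height _ X]subn0 -(card_interval 0 qn); exact: vertex_ideal_height.
apply: (@associated_of_covers _ _ _ K Q (witness k)).
- move=> C1 C2 h1 h2 h; apply: (no C1 C2 h1 h2) => i iq.
  by have := h i; rewrite inE iq mnmE iq => /(_ isT); case: (i < k).
- move=> i; rewrite inE /= => /yes[C1 [C2 [h1 h2 h3 h4]]]; exists C1, C2; split.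
  + by apply: base_cover => // x /h3 /andP[].
  + by apply: base_cover => // x /h3 /andP[].
  + move=> j; rewrite mnmE; have [jq|qj] := ltnP j q.
      by have := h4 j jq; case: (j < k).
    by have /andP[-> ->] := h3 j qj; have -> : (j < k) = false by lia.
Qed.

End Construction.

(** * A single edge: height equal to the edge size *)

Section SingleEdge.

Variables (K : fieldType) (n m : nat).
Hypotheses (mn : m <= n) (m2 : 2 <= m).

Let core : {set 'I_n} := [set x : 'I_n | 0 <= x < m].

(** Any two covers meet [core], where [witness 1] has a single variable, of
    exponent [1]. *)
Lemma single_edge_case : exists H : hypergraph m n,
  hypergraph_connected H /\
  exists P : set {mpoly K[n]},
    associated_prime (ideal_exp (edge_ideal_dual H K) 2) P /\ has_height P m.
Proof.
pose base := pred1 core.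
have n0 : 0 < n by lia.
have coreE : core \in base_edges m m base.
  by rewrite inE card_interval // subn0 /= !eqxx.
exists (base_hypergraph m m base); split.
  apply: (@base_connected _ _ _ _ (Ordinal n0)); first by rewrite m2.
  move=> i im; apply: connect1; apply/existsP; exists core.
  by rewrite coreE !inE /= im; lia.
apply: (@base_associated _ _ _ _ _ 1) => //; first exact: ltnW.
- move=> C1 C2 /(_ _ coreE)[x1 x1e x1C] /(_ _ coreE)[x2 x2e x2C] h.
  move: x1e x2e; rewrite !inE /= => x1m x2m.
  have := h _ x1m; have := h _ x2m; rewrite x1C x2C => h2 h1.
  have x12 : x1 = x2 by apply/val_inj; rewrite /=; lia.
  by move: h1 x2C; rewrite x12 => h1 x2C; rewrite x2C in h1; lia.
- move=> i im.
  exists [set x : 'I_n | (m <= x) || (x == 0 :> nat)].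
  exists [set x : 'I_n | (m <= x) || (x == i)]; split.
  + by move=> e /eqP->; exists (Ordinal n0); rewrite !inE /=; lia.
  + by move=> e /eqP->; exists i; rewrite !inE /= ?im // eqxx orbT.
  + by move=> x mx; rewrite !inE mx.
  + move=> x xm; rewrite !inE (leqNgt m) xm /= (eq_sym i).
    by rewrite ltnS leqn0.
Qed.

End SingleEdge.

(** * Odd cycles *)

(** The colouring of the path [0, 1, 2, ...] that alternates, except that [t - 1]
    and [t] have the same colour if [t > 0]. *)
Definition alternating (t j : nat) := odd j (+) (j < t).

Lemma alternating_succ t j :
  alternating t j = alternating t j.+1 -> t = j.+1.
Proof. by rewrite /alternating /=; case: (odd j); lia. Qed.

(** An odd cycle has no proper 2-colouring, even a partial one: two disjoint
    sets of vertices cannot both meet all its edges. *)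
Lemma odd_cycle_no_2covers k (c1 c2 : nat -> bool) : odd k -> 1 < k ->
  (forall j, j < k -> ~~ (c1 j && c2 j)) ->
  (forall j, j.+1 < k -> (c1 j || c1 j.+1) && (c2 j || c2 j.+1)) ->
  (c1 0 || c1 k.-1) && (c2 0 || c2 k.-1) -> False.
Proof.
move=> ok k1 dis links closing.
have alt j : j < k -> c1 j = c1 0 (+) odd j.
  elim: j => [_|j IH jk]; first by rewrite addbF.
  have := dis j.+1 jk; have := dis j (ltnW jk); have := links j jk.
  rewrite /= addbN -IH ?(ltnW jk) //.
  by case: (c1 j) (c1 j.+1) (c2 j) (c2 j.+1) => [] [] [] [].
have k0 : k.-1 < k by lia.
have := alt _ k0; have -> : odd k.-1 = false by lia.
have := dis _ k0; have := dis 0 (ltnW k1); move: closing.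
by case: (c1 0) (c1 k.-1) (c2 0) (c2 k.-1) => [] [] [] [].
Qed.

Section OddCycle.

Variables (K : fieldType) (n q m k : nat).
Hypotheses (qn : q <= n) (m3 : 3 <= m) (ok : odd k) (k1 : 1 < k).
(* [k] is [q - m + 2] or [q - m + 1]. *)
Hypotheses (kq1 : k + m <= q + 2) (kq2 : q + 1 <= k + m).

(** The edges of the cycle, thickened to [m]-sets by the last, respectively the
    first, [m - 2] of the vertices [k, ..., q - 1]. *)
Let link j := two_intervals n j j.+2 (q + 2 - m) q.
Let closing := two_intervals n 0 1 k.-1 (k + m - 2).
Let base : pred {set 'I_n} := fun e =>
  (e == closing) || [exists j : 'I_n, (j.+1 < k) && (e == link j)].

Lemma closing_edge : closing \in base_edges m q base.
Proof. by rewrite inE card_two_intervals /base ?eqxx //=; lia. Qed.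

Lemma link_edge j : j.+1 < k -> link j \in base_edges m q base.
Proof.
move=> jk; have jn : j < n by lia.
rewrite inE card_two_intervals; try lia.
apply/andP; split; first lia.
apply/orP; left; apply/orP; right; apply/existsP; exists (Ordinal jn).
by rewrite /= jk eqxx.
Qed.

Lemma baseP (C : {set 'I_n}) :
  (exists2 x, x \in closing & x \in C) ->
  (forall j, j.+1 < k -> exists2 x, x \in link j & x \in C) ->
  forall e, base e -> exists2 x, x \in e & x \in C.
Proof.
move=> hc hl e /orP[/eqP->//|/existsP[j /andP[jk /eqP->]]]; exact: hl.
Qed.

Lemma odd_cycle_connected : hypergraph_connected (base_hypergraph m q base).
Proof.
have n0 : 0 < n by lia.
pose v0 := Ordinal n0.
have share e (x y : 'I_n) : e \in base_edges m q base -> x \in e -> y \in e ->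
    connect (share_edge (base_hypergraph m q base)) x y.
  by move=> he xe ye; apply: connect1; apply/existsP; exists e; rewrite he xe ye.
apply: (@base_connected _ _ _ _ v0); first lia.
move=> x xq; have [xk|kx] := ltnP x k; last first.
  have [xm|mx] := ltnP x (k + m - 2).
    by apply: (share _ _ _ closing_edge); rewrite inE /=; lia.
  have k0 : 0.+1 < k by [].
  by apply: (share _ _ _ (link_edge k0)); rewrite inE /=; lia.
case: x xk {xq} => j jn /=; elim: j jn => [|j IH] jn jk.
  by rewrite (_ : Ordinal jn = v0) ?connect0 //; apply/val_inj.
apply: connect_trans (IH (ltnW jn) (ltnW jk)).
by apply: (share _ _ _ (link_edge jk)); rewrite inE /=; lia.
Qed.

(** Once any vertex [i] of the first [q] may be used one more time, the two colour
    classes extend to covers. *)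
Lemma odd_cycle_critical (i : 'I_n) : i < q -> exists C1 C2 : {set 'I_n},
  [/\ forall e, base e -> exists2 x, x \in e & x \in C1,
      forall e, base e -> exists2 x, x \in e & x \in C2,
      forall x : 'I_n, q <= x -> (x \in C1) && (x \in C2)
    & forall x : 'I_n, x < q ->
        (x \in C1) + (x \in C2) <= (x < k) + (i == x)].
Proof.
move=> iq.
(* The monochromatic edge of the colouring is one that contains [i]. *)
have [t ht] : exists t : nat, [|| (i < k) && (t == i),
    [&& k <= i, t == k & i < k + m - 2]
    | [&& k <= i, t == 1 & q + 2 - m <= i]].
  have [ik|ki] := ltnP i k; first by exists i; rewrite eqxx.
  by have [h|h] := ltnP i (k + m - 2); [exists k|exists 1]; lia.
pose X := alternating t.
exists [set x : 'I_n | [|| q <= x, (x < k) && ~~ X x | x == i]].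
exists [set x : 'I_n | (q <= x) || (x < k) && (X x || (x == i))].
have ex j : j < k -> exists2 x : 'I_n, x = j :> nat & (x == i) = (j == i).
  move=> jk; have jn : j < n by lia.
  by exists (Ordinal jn).
have X0 : X 0 = (0 < t) by [].
have Xk : X k.-1 = (k.-1 < t) by rewrite /X /alternating; lia.
have [v0 v0E v0i] := ex 0 (ltnW k1).
have [v1 v1E v1i] := ex k.-1 (ltac:(lia)).
split.
- apply: baseP => [|j jk].
  + have [x0|x0] := boolP (X 0); last first.
      by exists v0; rewrite !inE v0E ?x0 //=; lia.
    have [x1|x1] := boolP (X k.-1); last first.
      by exists v1; rewrite !inE v1E ?x1 //=; lia.
    by exists i; rewrite !inE ?eqxx ?orbT //; lia.
  + have [u uE ui] := ex j (ltnW jk); have [w wE wi] := ex _ jk.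
    have [x0|x0] := boolP (X j); last by exists u; rewrite !inE uE ?x0 //=; lia.
    have [x1|x1] := boolP (X j.+1); last by exists w; rewrite !inE wE ?x1 //=; lia.
    have tj : t = j.+1 by apply: alternating_succ; rewrite -/X x0 x1.
    by exists i; rewrite !inE ?eqxx ?orbT //; lia.
- apply: baseP => [|j jk].
  + have [x0|x0] := boolP (X 0); first by exists v0; rewrite !inE v0E ?x0 //=; lia.
    have [x1|x1] := boolP (X k.-1); first by exists v1; rewrite !inE v1E ?x1 //=; lia.
    by exists v0; rewrite !inE v0E ?v0i //=; lia.
  + have [u uE ui] := ex j (ltnW jk); have [w wE wi] := ex _ jk.
    have [x0|x0] := boolP (X j); first by exists u; rewrite !inE uE ?x0 //=; lia.
    have [x1|x1] := boolP (X j.+1); first by exists w; rewrite !inE wE ?x1 //=; lia.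
    have tj : t = j.+1.
      by apply: alternating_succ; rewrite -/X (negPf x0) (negPf x1).
    have [t1|t1] := eqVneq t 1.
      have j0 : j = 0 by lia.
      by case/negP: x0; rewrite j0 X0 t1.
    by exists w; rewrite !inE wE ?wi //=; lia.
- by move=> x qx; rewrite !inE qx.
- move=> x xq; rewrite !inE (leqNgt q) xq /= (eq_sym i).
  by case: (x < k); case: (X x); case: (x == i).
Qed.

Lemma odd_cycle_not_2coverable (C1 C2 : {set 'I_n}) :
  is_cover (base_hypergraph m q base) C1 ->
  is_cover (base_hypergraph m q base) C2 ->
  (forall i : 'I_n, i < q -> (i \in C1) + (i \in C2) <= (i < k)) -> False.
Proof.
move=> h1 h2 h.
pose c (C : {set 'I_n}) j := oapp (fun x => x \in C) false (insub j).
have cE C (x : 'I_n) : c C x = (x \in C) by rewrite /c valK.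
have C1k (x : 'I_n) : x < q -> x \in C1 -> x < k.
  by move=> /h xC xC1; move: xC; rewrite xC1; case: (x < k).
have C2k (x : 'I_n) : x < q -> x \in C2 -> x < k.
  by move=> /h xC xC2; move: xC; rewrite xC2 addn1; case: (x < k).
have hit C e a b : is_cover (base_hypergraph m q base) C ->
    (forall x : 'I_n, x < q -> x \in C -> x < k) ->
    e \in base_edges m q base ->
    (forall x : 'I_n, x \in e -> x < q /\ (x < k -> x = a :> nat \/ x = b :> nat)) ->
    c C a || c C b.
  move=> hC Ck he hab; have [x /hab[xq xab] xC] := hC _ he.
  by case: (xab (Ck _ xq xC)) => <-; rewrite cE xC ?orbT.
apply: (@odd_cycle_no_2covers k (c C1) (c C2)) => //.
- move=> j jk; have jn : j < n by lia.
  have := h (Ordinal jn); rewrite -!cE /= jk => /(_ (ltac:(lia))).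
  by case: (c C1 j) (c C2 j) => [] [].
- move=> j jk; rewrite (hit C1 _ _ _ h1 C1k (link_edge jk)).
    by rewrite (hit C2 _ _ _ h2 C2k (link_edge jk)) // => x; rewrite inE; lia.
  by move=> x; rewrite inE; lia.
- rewrite (hit C1 _ _ _ h1 C1k closing_edge).
    by rewrite (hit C2 _ _ _ h2 C2k closing_edge) // => x; rewrite inE; lia.
  by move=> x; rewrite inE; lia.
Qed.

Lemma odd_cycle_case : exists H : hypergraph m n,
  hypergraph_connected H /\
  exists P : set {mpoly K[n]},
    associated_prime (ideal_exp (edge_ideal_dual H K) 2) P /\ has_height P q.
Proof.
exists (base_hypergraph m q base); split; first exact: odd_cycle_connected.
apply: (@base_associated _ _ _ _ _ k) => //; first by lia.
- exact: odd_cycle_not_2coverable.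
- exact: odd_cycle_critical.
Qed.

End OddCycle.

Theorem corollary2p7 (K : fieldType) (n q m : nat) :
  (q <= n)%N -> (m <= q)%N -> (3 <= m)%N ->
  exists H : hypergraph m n,
    hypergraph_connected H /\
    exists P : set {mpoly K[n]},
      associated_prime (ideal_exp (edge_ideal_dual H K) 2) P /\
      has_height P q.
Proof.
move=> qn; rewrite leq_eqVlt => /orP[/eqP E|mq] m3.
  by subst q; apply: single_edge_case => //; lia.
have [odd1|even1] := boolP (odd (q + 2 - m)).
- by apply: (@odd_cycle_case _ _ _ _ (q + 2 - m)) => //; lia.
- by apply: (@odd_cycle_case _ _ _ _ (q + 1 - m)) => //; lia.
Qed.
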